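(* Let $\Delta$ be a finite ground set. For any set systems $\Omega,\Omega'\subseteq\mathscr P(\Delta)$ the following hold. A. Complement. (A1) $\overline{\emptyset}=\mathscr P(\Delta)$ and $\overline{\mathscr P(\Delta)}=\emptyset$. (A2) $\Omega\subseteq\Omega'$ iff $\overline\Omega\supseteq\overline{\Omega'}$. (A3) If $\Omega$ is upper (resp. lower), then $\overline\Omega$ is lower (resp. upper). (A4) $\overline{\overline\Omega}=\Omega$. B. Element-complement. (B1) $\widehat\emptyset=\emptyset$ and $\widehat{\mathscr P(\Delta)}=\mathscr P(\Delta)$. (B2) $\Omega\subseteq\Omega'$ iff $\widehat\Omega\subseteq\widehat{\Omega'}$. (B3) If $\Omega$ is upper (resp. lower), then $\widehat\Omega$ is lower (resp. upper). (B4) $\widehat{\widehat\Omega}=\Omega$. C. Cut. (C1) $\mathcal C(\emptyset)=\mathscr P(\Delta)$ and $\mathcal C(\mathscr P(\Delta))=\emptyset$. (C2) $\mathcal C(\Omega)=\emptyset$ iff $\emptyset\in\Omega$. (C3) $\mathcal C(\Omega)$ is an upper system. (C4) $\mathcal C(\Omega)=\mathcal C(m(\Omega))$. (C5) $\Omega\subseteq\Omega'$ implies $\mathcal C(\Omega)\supseteq\mathcal C(\Omega')$. (C6) $\mathcal C(\mathcal C(\Omega))=\uparrow\Omega$. D. Cocut. (D1) $\mathcal G(\emptyset)=\mathscr P(\Delta)$ and $\mathcal G(\mathscr P(\Delta))=\emptyset$. (D2) $\mathcal G(\Omega)=\emptyset$ iff $\Delta\in\Omega$. (D3) $\mathcal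 G(\Omega)$ is a lower system. (D4) $\mathcal G(\Omega)=\mathcal G(M(\Omega))$. (D5) $\Omega\subseteq\Omega'$ implies $\mathcal G(\Omega)\supseteq\mathcal G(\Omega')$. (D6) $\mathcal G(\mathcal G(\Omega))=\downarrow\Omega$. E. Interactions. (E1) $\widehat{\overline\Omega}=\overline{\widehat\Omega}$. (E2) $\uparrow\widehat\Omega=\widehat{\downarrow\Omega}$ and $\downarrow\widehat\Omega=\widehat{\uparrow\Omega}$. (E3) $\widehat{M(\Omega)}=m(\widehat\Omega)$ and $\widehat{m(\Omega)}=M(\widehat\Omega)$. (E4) $\mathcal C(\widehat\Omega)=\widehat{\mathcal G(\Omega)}$ and $\mathcal G(\widehat\Omega)=\widehat{\mathcal C(\Omega)}$. (E5) $\overline{\uparrow\Omega}\subseteq\downarrow\overline\Omega$ and $\overline{\downarrow\Omega}\subseteq\uparrow\overline\Omega$. (E6) $m(\overline\Omega)\subseteq\overline{M(\Omega)}$ and $M(\overline\Omega)\subseteq\overline{m(\Omega)}$. (E7) $\mathcal G(\overline\Omega)\subseteq\overline{\mathcal C(\Omega)}$, with equality iff $\Omega$ is upper; and $\mathcal C(\overline\Omega)\subseteq\overline{\mathcal G(\Omega)}$, with equality iff $\Omega$ is lower.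
   Context: A set system is a subset of the power set $\mathscr P(\Delta)$. $\Omega$ is upper (upper-closed) if $T\in\Omega$ and $T\subseteq T'\subseteq\Delta$ imply $T'\in\Omega$; it is lower (lower-closed) if $T\in\Omega$ and $T'\subseteq T$ imply $T'\in\Omega$. Operators: $\uparrow\Omega:=\{T\subseteq\Delta\mid T\supseteq T'\text{ for some }T'\in\Omega\}$; $\downarrow\Omega:=\{T\subseteq\Delta\mid T\subseteq T'\text{ for some }T'\in\Omega\}$; $m(\Omega)$ and $M(\Omega)$ are the families of inclusion-minimal and inclusion-maximal members of $\Omega$; complement $\overline\Omega:=\mathscr P(\Delta)\setminus\Omega$; element-complement $\widehat\Omega:=\{\Delta\setminus T\mid T\in\Omega\}$; cut operator $\mathcal C(\Omega):=\{S\subseteq\Delta\mid S\cap T\ne\emptyset\ \forall T\in\Omega\}$; cocut operator $\mathcal G(\Omega):=\{S\subseteq\Delta\mid S\cup T\neq\Delta\ \forall T\in\Omega\}$. *)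

(* Defs.v *)
From mathcomp Require Import all_boot.
Set Implicit Arguments.
Unset Strict Implicit.
Unset Printing Implicit Defensive.

(* The finite ground set is the carrier of a finType Delta, so the power set
   of the ground set is [set: {set Delta}], and the complement of a set system
   and the complement of a set are both the library's ~: (at the types
   {set {set Delta}} and {set Delta} respectively). *)

Definition upper_system (Delta : finType) (Omega : {set {set Delta}}) : Prop :=
  forall T T' : {set Delta}, T \in Omega -> T \subset T' -> T' \in Omega.

Definition lower_system (Delta : finType) (Omega : {set {set Delta}}) : Prop :=
  forall T T' : {set Delta}, T \in Omega -> T' \subset T -> T' \in Omega.

Definition up_closure (Delta : finType) (Omega : {set {set Delta}}) :
    {set {set Delta}} :=
  [set T : {set Delta} | [exists T' in Omega, T' \subset T]].

Definition down_closure (Delta : finType) (Omega : {set {set Delta}}) :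
    {set {set Delta}} :=
  [set T : {set Delta} | [exists T' in Omega, T \subset T']].

Definition min_members (Delta : finType) (Omega : {set {set Delta}}) :
    {set {set Delta}} :=
  [set T : {set Delta} | minset (mem Omega) T].

Definition max_members (Delta : finType) (Omega : {set {set Delta}}) :
    {set {set Delta}} :=
  [set T : {set Delta} | maxset (mem Omega) T].

Definition elem_compl (Delta : finType) (Omega : {set {set Delta}}) :
    {set {set Delta}} :=
  [set ~: T | T in Omega].

Definition cut (Delta : finType) (Omega : {set {set Delta}}) :
    {set {set Delta}} :=
  [set S : {set Delta} | [forall T in Omega, S :&: T != set0]].

Definition cocut (Delta : finType) (Omega : {set {set Delta}}) :
    {set {set Delta}} :=
  [set S : {set Delta} | [forall T in Omega, S :|: T != [set: Delta]]].

(* Main.v *)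
Require Import Defs.
From mathcomp Require Import all_boot.
Set Implicit Arguments.
Unset Strict Implicit.
Unset Printing Implicit Defensive.

(** Two observations reduce the whole calculus of operators to the elementary
    theory of one closure operator, [up_closure].

    First, [S] is disjoint from [T] exactly when [T] is contained in [~: S], so
    [S] fails to cut [Omega] exactly when [~: S] lies above a member of [Omega]:
    [cut Omega = elem_compl (~: up_closure Omega)] (lemma [cut_up]).  The two
    outer operations are commuting involutions, each exchanging upper and lower
    systems; hence [cut Omega] is upper, depends on [Omega] only through its
    up-closure (hence only through its minimal members), and cutting twice
    returns [up_closure Omega].

    Second, taking complements of elements reverses inclusion between sets, so
    conjugation by the involution [elem_compl] exchanges [up_closure] with
    [down_closure], [min_members] with [max_members], and [cut] with [cocut].
    The duality statements are these conjugation identities, and the properties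
    of [cocut] are obtained by conjugating those of [cut].

    For the comparison of [cocut (~: Omega)] with [~: cut Omega], both sides are
    the [elem_compl] of a system around [Omega]: the left one comes from
    [~: down_closure (~: Omega)], the largest upper system inside [Omega], the
    right one from [up_closure Omega], the smallest upper system containing it.
    The inclusion is immediate, and the two agree exactly when [Omega] is itself
    upper. *)

Section SetSystems.

Variable Delta : finType.
Implicit Types (Omega : {set {set Delta}}) (S T : {set Delta}).

(** * Complementation of elements *)

Lemma in_elem_compl Omega T : (T \in elem_compl Omega) = (~: T \in Omega).
Proof.
apply/imsetP/idP => [[S SO ->]|TO]; first by rewrite setCK.
by exists (~: T); rewrite ?setCK.
Qed.

Lemma elem_complK : involutive (@elem_compl Delta).
Proof. by move=> Omega; apply/setP => T; rewrite !in_elem_compl setCK. Qed.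

Lemma elem_complC Omega : elem_compl (~: Omega) = ~: elem_compl Omega.
Proof. by apply/setP => T; rewrite !(in_elem_compl, inE). Qed.

Lemma elem_compl0 : elem_compl set0 = set0 :> {set {set Delta}}.
Proof. by apply/setP => T; rewrite in_elem_compl !inE. Qed.

Lemma elem_complT : elem_compl [set: {set Delta}] = [set: {set Delta}].
Proof. by apply/setP => T; rewrite in_elem_compl !inE. Qed.

Lemma elem_complS Omega Omega' :
  (elem_compl Omega \subset elem_compl Omega') = (Omega \subset Omega').
Proof.
apply/idP/idP; last exact: imsetS.
by move/(imsetS (fun T => ~: T)); rewrite -!/(elem_compl _) !elem_complK.
Qed.

Lemma elem_compl_eq0 Omega : (elem_compl Omega == set0) = (Omega == set0).
Proof. by rewrite -{1}elem_compl0 (inj_eq (inv_inj elem_complK)). Qed.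

Lemma upper_elem_compl Omega :
  upper_system Omega -> lower_system (elem_compl Omega).
Proof.
move=> upO T T'; rewrite !in_elem_compl => TO sT.
by apply: upO TO _; rewrite setCS.
Qed.

Lemma lower_elem_compl Omega :
  lower_system Omega -> upper_system (elem_compl Omega).
Proof.
move=> lowO T T'; rewrite !in_elem_compl => TO sT.
by apply: lowO TO _; rewrite setCS.
Qed.

Lemma upper_elem_complE Omega :
  upper_system (elem_compl Omega) <-> lower_system Omega.
Proof.
split=> [upO|]; last exact: lower_elem_compl.
by rewrite -[Omega]elem_complK; apply: upper_elem_compl.
Qed.

Lemma upper_setC Omega : upper_system Omega -> lower_system (~: Omega).
Proof.
move=> upO T T'; rewrite !inE => nO sT.
by apply: contra nO => /upO; apply.
Qed.

Lemma lower_setC Omega : lower_system Omega -> upper_system (~: Omega).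
Proof.
move=> lowO T T'; rewrite !inE => nO sT.
by apply: contra nO => /lowO; apply.
Qed.

(** * Closures and extremal members *)

Lemma up_closureP Omega T :
  reflect (exists2 T', T' \in Omega & T' \subset T) (T \in up_closure Omega).
Proof. by rewrite inE; apply: exists_inP. Qed.

Lemma down_closureP Omega T :
  reflect (exists2 T', T' \in Omega & T \subset T') (T \in down_closure Omega).
Proof. by rewrite inE; apply: exists_inP. Qed.

Lemma sub_up_closure Omega : Omega \subset up_closure Omega.
Proof. by apply/subsetP => T TO; apply/up_closureP; exists T. Qed.

Lemma sub_down_closure Omega : Omega \subset down_closure Omega.
Proof. by apply/subsetP => T TO; apply/down_closureP; exists T. Qed.

Lemma up_closure_upper Omega : upper_system (up_closure Omega).
Proof.
move=> T T' /up_closureP[S SO sST] sTT'.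
by apply/up_closureP; exists S; last exact: subset_trans sTT'.
Qed.

Lemma up_closure_id Omega : upper_system Omega -> up_closure Omega = Omega.
Proof.
move=> upO; apply/eqP; rewrite eqEsubset sub_up_closure andbT.
by apply/subsetP => T /up_closureP[S /upO]; apply.
Qed.

Lemma up_closureS Omega Omega' :
  Omega \subset Omega' -> up_closure Omega \subset up_closure Omega'.
Proof.
move=> /subsetP sO; apply/subsetP => T /up_closureP[S /sO SO' sST].
by apply/up_closureP; exists S.
Qed.

Lemma up_closure0 : up_closure set0 = set0 :> {set {set Delta}}.
Proof. by apply: up_closure_id => T T'; rewrite inE. Qed.

(** The empty set is the least set, so it lies in an up-closure only by being
    one of the generators, and then everything lies above it. *)
Lemma up_closure_eqT Omega :
  (up_closure Omega == [set: {set Delta}]) = (set0 \in Omega).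
Proof.
apply/eqP/idP => [upE|O0]; last first.
  apply/setP => T; rewrite [RHS]inE; apply/up_closureP.
  by exists set0; rewrite ?sub0set.
have /up_closureP[T TO]: set0 \in up_closure Omega by rewrite upE inE.
by rewrite subset0 => /eqP <-.
Qed.

Lemma min_members_sub Omega : min_members Omega \subset Omega.
Proof. by apply/subsetP => T; rewrite inE => /minsetp. Qed.

Lemma max_members_sub Omega : max_members Omega \subset Omega.
Proof. by apply/subsetP => T; rewrite inE => /maxsetp. Qed.

(** Finiteness of the ground set enters here: every member contains a minimal
    one, so the minimal members generate the same upper system. *)
Lemma up_closure_min Omega : up_closure (min_members Omega) = up_closure Omega.
Proof.
apply/eqP; rewrite eqEsubset up_closureS ?min_members_sub //=.
apply/subsetP => T /up_closureP[S SO sST].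
have [U minU sUS] := @minset_exists _ (mem Omega) S SO.
by apply/up_closureP; exists U; rewrite ?inE ?(subset_trans sUS).
Qed.

(** * Duality under complementation of elements *)

Lemma up_elem_compl Omega :
  up_closure (elem_compl Omega) = elem_compl (down_closure Omega).
Proof.
apply/setP => T; rewrite in_elem_compl.
apply/up_closureP/down_closureP => -[S SO sST].
  by exists (~: S); rewrite -?in_elem_compl ?setCS.
by exists (~: S); rewrite ?in_elem_compl ?setCK // subCset.
Qed.

Lemma down_elem_compl Omega :
  down_closure (elem_compl Omega) = elem_compl (up_closure Omega).
Proof.
by apply: (inv_inj elem_complK); rewrite -up_elem_compl !elem_complK.
Qed.

Lemma min_elem_compl Omega :
  min_members (elem_compl Omega) = elem_compl (max_members Omega).
Proof.
apply/setP => T; rewrite in_elem_compl !inE maxminset.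
(* [maxminset] turns maximality of [~: T] into minimality of [~: ~: T]. *)
by rewrite setCK; apply: minset_eq => S; rewrite /= in_elem_compl.
Qed.

Lemma max_elem_compl Omega :
  max_members (elem_compl Omega) = elem_compl (min_members Omega).
Proof.
by apply: (inv_inj elem_complK); rewrite -min_elem_compl !elem_complK.
Qed.

Lemma down_closure_id Omega : lower_system Omega -> down_closure Omega = Omega.
Proof.
move=> /lower_elem_compl/up_closure_id; rewrite up_elem_compl.
exact: (inv_inj elem_complK).
Qed.

(** * Cut and cocut *)

(** [S :&: T] is empty exactly when [T] is contained in [~: S]. *)
Lemma cut_up Omega : cut Omega = elem_compl (~: up_closure Omega).
Proof.
apply/setP => S; rewrite in_elem_compl inE in_setC.
apply/forall_inP/negP => [cutS /up_closureP[T TO]|nS T TO].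
  rewrite -disjoints_subset -setI_eq0 setIC; exact/negP/cutS.
apply/negP; rewrite setIC setI_eq0 disjoints_subset => sTS.
by apply/nS/up_closureP; exists T.
Qed.

(** [S :|: T] is the whole ground set exactly when [~: S] is contained in [T]. *)
Lemma cocut_down Omega : cocut Omega = elem_compl (~: down_closure Omega).
Proof.
have covE S T : (S :|: T == [set: Delta]) = (~: S \subset T).
  by rewrite -subTset -subDset setTD.
apply/setP => S; rewrite in_elem_compl inE in_setC.
apply/forall_inP/negP => [cocutS /down_closureP[T TO]|nS T TO].
  by rewrite -covE; apply/negP/cocutS.
apply/negP; rewrite covE => sST.
by apply/nS/down_closureP; exists T.
Qed.

Lemma cut_elem_compl Omega : cut (elem_compl Omega) = elem_compl (cocut Omega).
Proof. by rewrite cut_up cocut_down up_elem_compl !elem_complC. Qed.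

Lemma cocut_elem_compl Omega :
  cocut (elem_compl Omega) = elem_compl (cut Omega).
Proof.
by apply: (inv_inj elem_complK); rewrite -cut_elem_compl !elem_complK.
Qed.

(** The form in which every property of [cut] transfers to [cocut]. *)
Lemma cocut_dual Omega : cocut Omega = elem_compl (cut (elem_compl Omega)).
Proof. by rewrite cut_elem_compl elem_complK. Qed.

Lemma cut_eq0 Omega : (cut Omega == set0) = (set0 \in Omega).
Proof.
by rewrite cut_up elem_compl_eq0 -up_closure_eqT -setCT (inj_eq (@setC_inj _)).
Qed.

Lemma cut_upper Omega : upper_system (cut Omega).
Proof. by rewrite cut_up; apply/lower_elem_compl/upper_setC/up_closure_upper. Qed.

Lemma cut_min Omega : cut (min_members Omega) = cut Omega.
Proof. by rewrite !cut_up up_closure_min. Qed.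

Lemma cutS Omega Omega' : Omega \subset Omega' -> cut Omega' \subset cut Omega.
Proof. by move=> sO; rewrite !cut_up elem_complS setCS up_closureS. Qed.

Lemma cut0 : cut set0 = [set: {set Delta}].
Proof. by rewrite cut_up up_closure0 setC0 elem_complT. Qed.

(** The outer cut sees the upper system [cut Omega] as its own up-closure, so
    what remains is the square of an involution applied to [up_closure Omega]. *)
Lemma cut_cut Omega : cut (cut Omega) = up_closure Omega.
Proof.
rewrite cut_up (up_closure_id (@cut_upper Omega)) cut_up.
by rewrite -elem_complC setCK elem_complK.
Qed.

Lemma cocut0 : cocut set0 = [set: {set Delta}].
Proof. by rewrite cocut_dual elem_compl0 cut0 elem_complT. Qed.

Lemma cocut_eq0 Omega : (cocut Omega == set0) = ([set: Delta] \in Omega).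
Proof. by rewrite cocut_dual elem_compl_eq0 cut_eq0 in_elem_compl setC0. Qed.

Lemma cocut_lower Omega : lower_system (cocut Omega).
Proof. by rewrite cocut_dual; apply/upper_elem_compl/cut_upper. Qed.

Lemma cocut_max Omega : cocut (max_members Omega) = cocut Omega.
Proof. by rewrite !cocut_dual -min_elem_compl cut_min. Qed.

Lemma cocutS Omega Omega' :
  Omega \subset Omega' -> cocut Omega' \subset cocut Omega.
Proof. by move=> sO; rewrite !cocut_dual elem_complS cutS ?elem_complS. Qed.

Lemma cocut_cocut Omega : cocut (cocut Omega) = down_closure Omega.
Proof. by rewrite !cocut_dual elem_complK cut_cut up_elem_compl elem_complK. Qed.

(** * Cut, cocut and complementary systems *)

Lemma setC_down_setC_sub Omega : ~: down_closure (~: Omega) \subset Omega.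
Proof. by rewrite subCset sub_down_closure. Qed.

Lemma cocut_setC_sub Omega : cocut (~: Omega) \subset ~: cut Omega.
Proof.
rewrite cocut_down cut_up -elem_complC setCK elem_complS.
exact: subset_trans (setC_down_setC_sub Omega) (sub_up_closure Omega).
Qed.

(** [Omega] is squeezed between [~: down_closure (~: Omega)] and
    [up_closure Omega], so equality of the two makes it equal to its
    up-closure, hence upper. *)
Lemma cocut_setC_eq Omega :
  cocut (~: Omega) = ~: cut Omega <-> upper_system Omega.
Proof.
rewrite cocut_down cut_up -elem_complC setCK.
split=> [/(inv_inj elem_complK) eqO | upO].
  suff <-: up_closure Omega = Omega by apply: up_closure_upper.
  by apply/eqP; rewrite eqEsubset sub_up_closure -eqO setC_down_setC_sub.
by rewrite (down_closure_id (upper_setC upO)) setCK up_closure_id.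
Qed.

Lemma cut_setC_dual Omega :
  cut (~: Omega) = elem_compl (cocut (~: elem_compl Omega)).
Proof. by rewrite -elem_complC -cut_elem_compl elem_complK. Qed.

Lemma setC_cocut_dual Omega :
  ~: cocut Omega = elem_compl (~: cut (elem_compl Omega)).
Proof. by rewrite cocut_dual elem_complC. Qed.

Lemma cut_setC_sub Omega : cut (~: Omega) \subset ~: cocut Omega.
Proof. by rewrite cut_setC_dual setC_cocut_dual elem_complS cocut_setC_sub. Qed.

Lemma cut_setC_eq Omega :
  cut (~: Omega) = ~: cocut Omega <-> lower_system Omega.
Proof.
rewrite cut_setC_dual setC_cocut_dual.
apply: iff_trans (upper_elem_complE Omega).
apply: iff_trans (cocut_setC_eq (elem_compl Omega)).
by split=> [/(inv_inj elem_complK)|->].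
Qed.

(** [Omega] is contained in both of its closures and contains its extremal
    members; the remaining inclusions all factor through [~: Omega]. *)
Lemma setC_up_sub Omega : ~: up_closure Omega \subset down_closure (~: Omega).
Proof.
apply: subset_trans (sub_down_closure _).
by rewrite setCS sub_up_closure.
Qed.

Lemma setC_down_sub Omega : ~: down_closure Omega \subset up_closure (~: Omega).
Proof.
apply: subset_trans (sub_up_closure _).
by rewrite setCS sub_down_closure.
Qed.

Lemma min_setC_sub Omega : min_members (~: Omega) \subset ~: max_members Omega.
Proof.
apply: subset_trans (min_members_sub _) _.
by rewrite setCS max_members_sub.
Qed.

Lemma max_setC_sub Omega : max_members (~: Omega) \subset ~: min_members Omega.
Proof.
apply: subset_trans (max_members_sub _) _.
by rewrite setCS min_members_sub.
Qed.

End SetSystems.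

Theorem theorem5 (Delta : finType) (Omega Omega' : {set {set Delta}}) :
  [/\ (* A. Complement *)
   [/\ (* A1 *) ~: (set0 : {set {set Delta}}) = [set: {set Delta}] /\
                ~: [set: {set Delta}] = set0,
       (* A2 *) Omega \subset Omega' <-> ~: Omega' \subset ~: Omega,
       (* A3 *) (upper_system Omega -> lower_system (~: Omega)) /\
                (lower_system Omega -> upper_system (~: Omega)) &
       (* A4 *) ~: (~: Omega) = Omega],
   (* B. Element-complement *)
   [/\ (* B1 *) elem_compl (set0 : {set {set Delta}}) = set0 /\
                elem_compl [set: {set Delta}] = [set: {set Delta}],
       (* B2 *) Omega \subset Omega' <-> elem_compl Omega \subset elem_compl Omega',
       (* B3 *) (upper_system Omega -> lower_system (elem_compl Omega)) /\
                (lower_system Omega -> upper_system (elem_compl Omega)) &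
       (* B4 *) elem_compl (elem_compl Omega) = Omega],
   (* C. Cut *)
   [/\ (* C1 *) cut (set0 : {set {set Delta}}) = [set: {set Delta}] /\
                cut [set: {set Delta}] = set0,
       (* C2 *) cut Omega = set0 <-> set0 \in Omega,
       (* C3 *) upper_system (cut Omega),
       (* C4 *) cut Omega = cut (min_members Omega) &
       (* C5 *) (Omega \subset Omega' -> cut Omega' \subset cut Omega) /\
       (* C6 *) cut (cut Omega) = up_closure Omega],
   (* D. Cocut *)
   [/\ (* D1 *) cocut (set0 : {set {set Delta}}) = [set: {set Delta}] /\
                cocut [set: {set Delta}] = set0,
       (* D2 *) cocut Omega = set0 <-> [set: Delta] \in Omega,
       (* D3 *) lower_system (cocut Omega),
       (* D4 *) cocut Omega = cocut (max_members Omega) &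
       (* D5 *) (Omega \subset Omega' -> cocut Omega' \subset cocut Omega) /\
       (* D6 *) cocut (cocut Omega) = down_closure Omega] &
   (* E. Interactions *)
   [/\ (* E1 *) elem_compl (~: Omega) = ~: elem_compl Omega,
       (* E2 *) up_closure (elem_compl Omega) = elem_compl (down_closure Omega) /\
                down_closure (elem_compl Omega) = elem_compl (up_closure Omega),
       (* E3 *) elem_compl (max_members Omega) = min_members (elem_compl Omega) /\
                elem_compl (min_members Omega) = max_members (elem_compl Omega),
       (* E4 *) cut (elem_compl Omega) = elem_compl (cocut Omega) /\
                cocut (elem_compl Omega) = elem_compl (cut Omega) &
   [/\ (* E5 *) ~: up_closure Omega \subset down_closure (~: Omega) /\
                ~: down_closure Omega \subset up_closure (~: Omega),
       (* E6 *) min_members (~: Omega) \subset ~: max_members Omega /\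
                max_members (~: Omega) \subset ~: min_members Omega &
       (* E7 *) (cocut (~: Omega) \subset ~: cut Omega /\
                 (cocut (~: Omega) = ~: cut Omega <-> upper_system Omega)) /\
                (cut (~: Omega) \subset ~: cocut Omega /\
                 (cut (~: Omega) = ~: cocut Omega <-> lower_system Omega))]]].
Proof.
split.
- split; last exact: setCK.
  + by rewrite setC0 setCT.
  + by rewrite setCS.
  + by split; [apply: upper_setC | apply: lower_setC].
- split; last exact: elem_complK.
  + by rewrite elem_compl0 elem_complT.
  + by rewrite elem_complS.
  + by split; [apply: upper_elem_compl | apply: lower_elem_compl].
- split.
  + by split; [apply: cut0 | apply/eqP; rewrite cut_eq0 inE].
  + by rewrite -cut_eq0; split=> /eqP.
  + exact: cut_upper.
  + by rewrite cut_min.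
  + by split; [apply: cutS | apply: cut_cut].
- split.
  + by split; [apply: cocut0 | apply/eqP; rewrite cocut_eq0 inE].
  + by rewrite -cocut_eq0; split=> /eqP.
  + exact: cocut_lower.
  + by rewrite cocut_max.
  + by split; [apply: cocutS | apply: cocut_cocut].
- split.
  + exact: elem_complC.
  + by rewrite up_elem_compl down_elem_compl.
  + by rewrite min_elem_compl max_elem_compl.
  + by rewrite cut_elem_compl cocut_elem_compl.
  + split.
    * by rewrite setC_up_sub setC_down_sub.
    * by rewrite min_setC_sub max_setC_sub.
    * split; split; [exact: cocut_setC_sub | exact: cocut_setC_eq
                    |exact: cut_setC_sub | exact: cut_setC_eq].
Qed.
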